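(* Let $f(x)=\sum_{n\ge 1} a_n x^n$, where $a_n$ is the number of permutations of length $n$ that avoid both $4231$ and $3124$. Then \[ f(x)=\frac{1-8x+20x^2-20x^3+10x^4-2x^5-(1-4x+2x^2)\sqrt{1-4x}}{2(1-3x+x^2)(-1+5x-4x^2+x^3)}. \]
   Context: A permutation $\pi$ avoids $\sigma$ if no subsequence of $\pi$ is order-isomorphic to $\sigma$. The generating function counts nonempty permutations only (no constant term). *)

(* Defs.v *)
From mathcomp Require Import all_boot all_fingroup.

Set Implicit Arguments.
Unset Strict Implicit.
Unset Printing Implicit Defensive.

(* A pattern of length k, given in one-line notation as a function 'I_k -> nat
   (only the relative order of the values matters). The permutation s of
   length n contains the pattern iff there are positions f 0 < ... < f (k-1)
   such that the subsequence s (f 0), ..., s (f (k-1)) is order-isomorphic to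
   the pattern. *)
Definition contains (n k : nat) (s : 'S_n) (sigma : 'I_k -> nat) : bool :=
  [exists f : {ffun 'I_k -> 'I_n},
     [forall a : 'I_k, forall b : 'I_k,
        ((a < b) ==> (f a < f b)) &&
        ((s (f a) < s (f b)) == (sigma a < sigma b))]].

Definition avoids (n k : nat) (s : 'S_n) (sigma : 'I_k -> nat) : bool :=
  ~~ contains s sigma.

Definition pat4231 : 'I_4 -> nat := fun i => nth 0 [:: 4; 2; 3; 1] i.
Definition pat3124 : 'I_4 -> nat := fun i => nth 0 [:: 3; 1; 2; 4] i.

Definition av_count (n : nat) : nat :=
  #|[set s : 'S_n | avoids s pat4231 && avoids s pat3124]|.

(* Main.v *)
From mathcomp Require Import all_boot all_fingroup zify.
Require Import Defs.

(** Build the permutations by inserting the maximum [M] of each one.  Inserting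
    it in [l ++ r] keeps both patterns away iff [l] avoids 312 and [r] avoids
    231, so the active sites of a word are the sites of a factor [W]
    ([A ++ W ++ B]).  After the insertion [W1 | W2], the new factor is
    [L ++ M :: R], where [L] is the longest suffix of [W1] that lies below
    [W2 ++ B] and [R] the longest decreasing prefix of [W2].

    Starting from the word 0, only two shapes of factor appear: increasing
    sequences of decreasing layers with [B] empty, and such layers followed by a
    decreasing run [D1 ++ D2], with [D2] below [B] and [D1] not.  Their sizes
    therefore label a generating tree.  With [x = t / (1+t)^2], i.e. [1 + t] the
    Catalan series, the generating function of the descendants of each label has
    a closed form [state_gf]: a combination of powers of the roots [1 + t] and
    [1 + t + t^2] of the recurrences of the tree.  It satisfies
    [state_gf = 1 + x * sum over the children], and the partial sums satisfy the
    same recursion, so that the error after [n] levels is multiplied by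
    [O(x)] at each level with respect to a weight exponential in the size. *)

Set Implicit Arguments.
Unset Strict Implicit.
Unset Printing Implicit Defensive.

(** * Subsequences and the insertion of a maximum *)

Definition has_subseq (P : pred (seq nat)) (w : seq nat) : bool :=
  [exists m : (size w).-tuple bool, P (mask m w)].

Lemma has_subseqP (P : pred (seq nat)) w : reflect (exists2 t, subseq t w & P t) (has_subseq P w).
Proof.
apply: (iffP existsP) => [[m Pm]|[t /subseqP[m sz_m ->] Pt]].
  by exists (mask m w) => //; apply: mask_subseq.
by exists (tcast sz_m (in_tuple m)); rewrite val_tcast.
Qed.

Lemma has_subseq_short (P : pred (seq nat)) k w :
  (forall t, P t -> size t = k) -> size w < k -> has_subseq P w = false.
Proof.
by move=> Pk; apply: contraTF => /has_subseqP[t /size_subseq le /Pk <-]; rewrite -leqNgt.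
Qed.

Definition is231 (t : seq nat) := if t is [:: a; b; c] then (c < a) && (a < b) else false.
Definition is312 (t : seq nat) := if t is [:: a; b; c] then (b < c) && (c < a) else false.
Definition is4231 (t : seq nat) :=
  if t is [:: a; b; c; d] then [&& d < b, b < c & c < a] else false.
Definition is3124 (t : seq nat) :=
  if t is [:: a; b; c; d] then [&& b < c, c < a & a < d] else false.

Lemma subseq_catE (t l r : seq nat) :
  subseq t (l ++ r) -> exists t1 t2, [/\ t = t1 ++ t2, subseq t1 l & subseq t2 r].
Proof.
elim: l t => [|x l IH] t /=; first by exists [::], t.
case: t => [|y t]; first by exists [::], [::]; rewrite !sub0seq.
case: eqP => [->|ne] /IH[t1 [t2 [e s1 s2]]].
  by exists (x :: t1), t2; rewrite /= eqxx e.
exists t1, t2; split=> //; exact: subseq_trans s1 (subseq_cons _ _).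
Qed.

Lemma subseq_insert (t l r : seq nat) (M : nat) :
  subseq t (l ++ M :: r) ->
  subseq t (l ++ r) \/ exists t1 t2, [/\ t = t1 ++ M :: t2, subseq t1 l & subseq t2 r].
Proof.
move=> /subseq_catE[t1 [t2 [-> s1 s2]]].
case: t2 s2 => [|y t2] /=; first by rewrite cats0 => _; left; apply: subseq_trans s1 (prefix_subseq _ _).
case: eqP => [->|_] s2; [by right; exists t1, t2 | by left; apply: cat_subseq].
Qed.

Lemma subseq_insert_max (l r : seq nat) (M : nat) : subseq (l ++ r) (l ++ M :: r).
Proof. by apply: cat_subseq => //; apply: subseq_cons. Qed.

Section InsertMax.

Variables (l r : seq nat) (M : nat).
Hypotheses (l_lt : all (gtn M) l) (r_lt : all (gtn M) r).

Lemma subseq_lt_l t : subseq t l -> all (gtn M) t.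
Proof. by move=> /mem_subseq st; apply/allP => x /st /(allP l_lt). Qed.

Lemma subseq_lt_r t : subseq t r -> all (gtn M) t.
Proof. by move=> /mem_subseq st; apply/allP => x /st /(allP r_lt). Qed.

Lemma has231_insert :
  has_subseq is231 (l ++ M :: r) = has_subseq is231 (l ++ r) || ~~ allrel leq l r.
Proof.
apply/has_subseqP/orP => [[t /subseq_insert[st Pt|[t1 [t2 [-> s1 s2]]]]]|[h|]].
- by left; apply/has_subseqP; exists t.
- have h1 := subseq_lt_l s1; have h2 := subseq_lt_r s2.
  case: t1 t2 s1 s2 h1 h2 => [|a [|b [|c [|d t1]]]] [|a' [|b' [|c' t2]]] //=; rewrite /gtn /= => s1 s2 h1 h2.
  + lia.
  + case/andP => lt _; right; apply/negP => /allrelP/(_ a a').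
    rewrite -!sub1seq s1 s2; lia.
  + lia.
- by case/has_subseqP: h => t st Pt; exists t => //; apply: subseq_trans st (subseq_insert_max _ _ _).
- rewrite -has_predC => /hasP[x xl /allPn[y yr xy]].
  exists [:: x; M; y] => /=; last by have := allP l_lt _ xl; rewrite /=; lia.
  by rewrite -cat1s; apply: cat_subseq; rewrite ?sub1seq //= eqxx sub1seq.
Qed.

Lemma has312_insert :
  has_subseq is312 (l ++ M :: r) = has_subseq is312 (l ++ r) || ~~ pairwise geq r.
Proof.
apply/has_subseqP/orP => [[t /subseq_insert[st Pt|[t1 [t2 [-> s1 s2]]]]]|[h|]].
- by left; apply/has_subseqP; exists t.
- have h1 := subseq_lt_l s1; have h2 := subseq_lt_r s2.
  case: t1 t2 s1 s2 h1 h2 => [|a [|b [|c [|d t1]]]] [|a' [|b' [|c' t2]]] //=; rewrite /gtn /= => s1 s2 h1 h2.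
  + move=> /andP[lt _]; right; apply/negP => /(subseq_pairwise s2) /=; lia.
  + lia.
  + lia.
- by case/has_subseqP: h => t st Pt; exists t => //; apply: subseq_trans st (subseq_insert_max _ _ _).
- move=> np; have [x [y [sxy lt]]] : exists x y, subseq [:: x; y] r /\ x < y.
    elim: (r) np => [//|a s IH] /=; rewrite negb_and => /orP[/allPn[y ys lt]|/IH[x [y [sxy lt]]]].
      by exists a, y; rewrite /= eqxx sub1seq ys; split=> //; rewrite ltnNge.
    by exists x, y; split=> //; apply: subseq_trans sxy (subseq_cons _ _).
  exists [:: M; x; y] => /=; last by have := subseq_lt_r sxy; rewrite /= /gtn /=; lia.
  by rewrite -[_ :: _]cat0s; apply: cat_subseq; rewrite ?sub0seq //= eqxx.
Qed.

Lemma has4231_insert :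
  has_subseq is4231 (l ++ M :: r) = has_subseq is4231 (l ++ r) || has_subseq is231 r.
Proof.
apply/has_subseqP/orP => [[t /subseq_insert[st Pt|[t1 [t2 [-> s1 s2]]]]]|[h|]].
- by left; apply/has_subseqP; exists t.
- have h1 := subseq_lt_l s1; have h2 := subseq_lt_r s2.
  case: t1 t2 s1 s2 h1 h2 => [|a [|b [|c [|d [|e t1]]]]] [|a' [|b' [|c' [|d' t2]]]] //=; rewrite /gtn /= => s1 s2 h1 h2.
  + move=> /and3P[lt lt' _]; right; apply/has_subseqP; exists [:: a'; b'; c'] => //=; lia.
  + lia.
  + lia.
  + lia.
- by case/has_subseqP: h => t st Pt; exists t => //; apply: subseq_trans st (subseq_insert_max _ _ _).
- case/has_subseqP => t st; have h2 := subseq_lt_r st.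
  case: t st h2 => [|a [|b [|c [|d t]]]] //=; rewrite /gtn /= => st h2 /andP[lt lt'].
  exists [:: M; a; b; c] => /=; last by lia.
  by rewrite -[_ :: _]cat0s; apply: cat_subseq; rewrite ?sub0seq //= eqxx.
Qed.

Lemma has3124_insert :
  has_subseq is3124 (l ++ M :: r) = has_subseq is3124 (l ++ r) || has_subseq is312 l.
Proof.
apply/has_subseqP/orP => [[t /subseq_insert[st Pt|[t1 [t2 [-> s1 s2]]]]]|[h|]].
- by left; apply/has_subseqP; exists t.
- have h1 := subseq_lt_l s1; have h2 := subseq_lt_r s2.
  case: t1 t2 s1 s2 h1 h2 => [|a [|b [|c [|d [|e t1]]]]] [|a' [|b' [|c' [|d' t2]]]] //=; rewrite /gtn /= => s1 s2 h1 h2.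
  + lia.
  + lia.
  + lia.
  + move=> /and3P[lt lt' _]; right; apply/has_subseqP; exists [:: a; b; c] => //=; lia.
- by case/has_subseqP: h => t st Pt; exists t => //; apply: subseq_trans st (subseq_insert_max _ _ _).
- case/has_subseqP => t st; have h1 := subseq_lt_l st.
  case: t st h1 => [|a [|b [|c [|d t]]]] //=; rewrite /gtn /= => st h1 /andP[lt lt'].
  exists [:: a; b; c; M] => /=; last by lia.
  by rewrite -[[:: a; b; c; M]]/([:: a; b; c] ++ [:: M]); apply: cat_subseq => //; rewrite sub1seq mem_head.
Qed.

End InsertMax.

Definition good (w : seq nat) := ~~ has_subseq is4231 w && ~~ has_subseq is3124 w.

Definition active (l r : seq nat) := ~~ has_subseq is312 l && ~~ has_subseq is231 r.

Lemma good_insert (l r : seq nat) M : all (gtn M) (l ++ r) ->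
  good (l ++ M :: r) = good (l ++ r) && active l r.
Proof.
rewrite all_cat => /andP[hl hr].
rewrite /good /active has4231_insert // has3124_insert // !negb_or.
by rewrite andbACA [X in _ && X]andbC.
Qed.

(** * Children of a word and their active sites *)

Definition word_kids (w : seq nat) : seq (seq nat) :=
  [seq take p w ++ size w :: drop p w
     | p <- [seq p <- iota 0 (size w).+1 | active (take p w) (drop p w)]].

Fixpoint word_count (k : nat) (w : seq nat) : nat :=
  if k is k'.+1 then sumn [seq word_count k' w' | w' <- word_kids w] else 1.

(* The active sites of the word [A ++ W ++ B] are those inside [W] or at its two ends. *)
Definition node (A W B : seq nat) : Prop :=
  forall l r, l ++ r = A ++ W ++ B ->
    active l r = (size A <= size l <= size A + size W).

(** The split after the last letter of [W] is left out, which makes the list additive in [W];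
    [word_kids_node] adds it back with [rcons]. *)
Fixpoint splits (A W Z : seq nat) : seq (seq nat * seq nat) :=
  if W is x :: W' then (A, W ++ Z) :: splits (rcons A x) W' Z else [::].

Lemma splits_cat A W1 W2 Z :
  splits A (W1 ++ W2) Z = splits A W1 (W2 ++ Z) ++ splits (A ++ W1) W2 Z.
Proof.
elim: W1 A => [|x W1 IH] A /=; first by rewrite cats0.
by rewrite IH -catA cat_rcons.
Qed.

Lemma map_iota_splits A W Z :
  [seq (take p (A ++ W ++ Z), drop p (A ++ W ++ Z)) | p <- iota (size A) (size W)] =
  splits A W Z.
Proof.
elim: W A => [//|x W IH] A /=.
rewrite take_size_cat // drop_size_cat //; congr (_ :: _).
by rewrite -[in RHS]IH size_rcons cat_rcons.
Qed.

Lemma word_kids_node A W B : node A W B ->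
  word_kids (A ++ W ++ B) =
  [seq p.1 ++ size (A ++ W ++ B) :: p.2 | p <- rcons (splits A W B) (A ++ W, B)].
Proof.
move=> nd; set w := A ++ W ++ B.
have -> : rcons (splits A W B) (A ++ W, B) =
    [seq (take p w, drop p w) | p <- iota (size A) (size W).+1].
  rewrite -addn1 iotaD map_cat map_iota_splits /= cats1 /w catA.
  by rewrite take_size_cat ?drop_size_cat // size_cat.
rewrite -map_comp /word_kids; congr map.
(* The sites are cut into those before [W], the [(size W).+1] sites of [W], and those after it; the
   filter keeps exactly the middle block. *)
have sz : (size w).+1 = size A + ((size W).+1 + size B) by rewrite /w !size_cat; lia.
have act p : p <= size w -> active (take p w) (drop p w) = (size A <= p <= size A + size W).
  by move=> le; rewrite nd ?cat_take_drop // size_takel.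
rewrite (@eq_in_filter _ _ (fun p => size A <= p <= size A + size W)); last first.
  by move=> p; rewrite mem_iota => /andP[_ lt]; apply: act; lia.
rewrite sz !iotaD !filter_cat.
rewrite (@eq_in_filter _ _ pred0 (iota 0 _)) ?filter_pred0; last by move=> p; rewrite mem_iota /=; lia.
rewrite (@eq_in_filter _ _ predT (iota (0 + _) _)) ?filter_predT; last by move=> p; rewrite mem_iota /=; lia.
rewrite (@eq_in_filter _ _ pred0) ?filter_pred0; last by move=> p; rewrite mem_iota /=; lia.
by rewrite cats0.
Qed.

Lemma eq_cat (T : Type) (l r P Q : seq T) : l ++ r = P ++ Q ->
  (exists u, P = l ++ u /\ r = u ++ Q) \/ (exists u, l = P ++ u /\ Q = u ++ r).
Proof.
elim: l P => [|x l IH] [|y P] /= e.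
- by left; exists [::].
- by left; exists (y :: P).
- by right; exists (x :: l).
- case: e => -> /IH[[u [-> ->]]|[u [-> ->]]]; [left | right]; by exists u.
Qed.

Lemma node_insert A X L R Y B M :
  all (gtn M) (A ++ (X ++ L ++ R ++ Y) ++ B) ->
  node A (X ++ L ++ R ++ Y) B ->
  allrel leq L (R ++ Y ++ B) ->
  (forall X0 x, X = rcons X0 x -> has (gtn x) (R ++ Y ++ B)) ->
  pairwise geq R ->
  (forall y Y0, Y = y :: Y0 -> has (gtn y) R) ->
  node (A ++ X) (L ++ M :: R) (Y ++ B).
Proof.
move=> ltM nd hL hX hR hY l r.
set P := A ++ X ++ L; set Q := R ++ Y ++ B.
have ePQ : A ++ (X ++ L ++ R ++ Y) ++ B = P ++ Q by rewrite /P /Q -!catA.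
rewrite ePQ all_cat in ltM; case/andP: ltM => ltP ltQ.
rewrite (_ : (A ++ X) ++ _ = P ++ M :: Q); last by rewrite /P /Q -!catA.
have {}nd l' r' : l' ++ r' = P ++ Q ->
    active l' r' = (size A <= size l' <= size A + size (X ++ L ++ R ++ Y)).
  by move=> e; apply: nd; rewrite e ePQ.
move=> e; rewrite !size_cat /=.
have {e} [[t [eP er]]|[t [el eQ]]] : (exists t, P = l ++ t /\ r = t ++ M :: Q) \/
    (exists t, l = P ++ M :: t /\ Q = t ++ r).
  case: (eq_cat e) => [[u [eP er]]|[[|z u] /= [el eQ]]]; first by left; exists u.
    by left; exists [::]; rewrite el eQ !cats0.
  by case: eQ el => <- -> ->; right; exists u.
- move: (ltP); rewrite eP all_cat => /andP[ltl ltt].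
  rewrite /active er has231_insert // negb_or negbK andbA.
  rewrite -/(active l (t ++ Q)) nd ?catA -?eP //.
  have := eP; rewrite /P catA => eX.
  have szl := congr1 size eX; rewrite !size_cat in szl.
  (* Either the site lies in [A ++ X], with [u] between it and [L], or it lies in [L]. A nonempty
     [u] ends with the last letter of [X], which exceeds a letter of [Q]; if [X] is empty, the site
     is left of the old factor and was already inactive. *)
  case: (eq_cat (esym eX)) => [[u [eu et]]|[u [eu eL]]].
    have szu := congr1 size eu; rewrite !size_cat in szu.
    case: (lastP u) eu et szu => [|u0 x] eu et szu.
      by rewrite et cat0s (hL : allrel leq L Q) andbT; move: szu; rewrite /= !size_cat; lia.
    case: (lastP X) hX eu szu => [|X0 x'] hX eu szu; rewrite !size_rcons /= in szu *.
      by lia.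
    have /hasP[y yQ ltyx] := hX _ _ erefl.
    have := eu; rewrite -!rcons_cat => /rcons_inj[_ exx].
    have -> : allrel leq t Q = false.
      apply/negP => /allrelP/(_ x y); rewrite et mem_cat mem_rcons mem_head => /(_ isT yQ).
      by move: ltyx; rewrite /gtn /= exx; lia.
    by rewrite andbF; lia.
  have -> : allrel leq t Q.
    by apply/allrelP => x y xt yQ; apply: (allrelP hL) => //; rewrite eL mem_cat xt orbT.
  have := congr1 size eu; have := congr1 size eL; rewrite !size_cat; lia.
- have eR : R ++ Y ++ B = t ++ r by [].
  move: (ltQ); rewrite eQ all_cat => /andP[ltt ltr].
  rewrite /active el has312_insert // negb_or negbK.
  rewrite andbAC -/(active (P ++ t) r) nd; last by rewrite eQ catA.
  have szQ := congr1 size eR; rewrite !size_cat in szQ.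
  rewrite /P !size_cat /=.
  case: (eq_cat (esym eR)) => [[u [eu er]]|[u [eu eY]]].
    have -> : pairwise geq t by move: hR; rewrite eu pairwise_cat => /and3P[].
    by have := congr1 size eu; rewrite size_cat; lia.
  case: u eu eY => [|y u] eu eY.
    by rewrite eu cats0 hR; lia.
  have szt := congr1 size eu; rewrite size_cat /= in szt.
  case eYc: Y => [|y' Y']; first by rewrite andbC; move: szQ; rewrite eYc /=; lia.
  have /hasP[x xR ltxy] := hY _ _ eYc; rewrite eYc in eY; case: eY => ey _.
  have -> : pairwise geq t = false.
    apply/negP; rewrite eu pairwise_cat => /and3P[/allrelP/(_ x y)].
    by rewrite mem_head => /(_ xR isT); move: ltxy; rewrite /gtn /geq /= ey; lia.
  by rewrite andbF; lia.
Qed.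

(** * Labels of the generating tree *)

(* Layers are listed from last to first, by size.  [Open c m] has [B] empty and a
   last layer of size [m.+1] after the layers [c]; [Closed c s r] has the layers [c],
   [size D1 = s] and [size D2 = r]. *)
Inductive state :=
  | Open of seq nat & nat
  | Closed of seq nat & nat & nat.

Fixpoint down (m : nat) : seq nat := if m is m'.+1 then m :: down m' else [::].

(** Before a layer of size [m], the new maximum becomes [D1], the layer becomes [D2], and the
    earlier layers survive. Inside the layer, with [j] of its letters to the right, nothing to the
    left survives. *)
Fixpoint layer_kids (c : seq nat) : seq state :=
  if c is m :: c' then
    layer_kids c' ++ Closed c' 1 m :: [seq Closed [::] 1 j | j <- down m.-1]
  else [::].

(** The children follow the sites from left to right: at the layers, before the final run, inside
    it, at the end. In the [Closed] case [j] counts the new maximum, so [j = 1] is the site between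
    [D1] and [D2]; at the end of a nonempty [D2], all of [D2] turns into a layer. *)
Definition kids (st : state) : seq state :=
  match st with
  | Open c m =>
      layer_kids c ++
      Open c m.+1 :: [seq Open [::] j | j <- down m] ++ [:: Open (m.+1 :: c) 0]
  | Closed c s r =>
      layer_kids c ++
      Closed c s.+1 r :: [seq Closed [::] j r | j <- down s] ++
      (if r is r'.+1 then
         [seq Closed [::] 1 j | j <- down r'] ++ [:: Closed [:: r] 1 0]
       else [::])
  end.

Fixpoint tree_count (k : nat) (st : state) : nat :=
  if k is k'.+1 then sumn [seq tree_count k' st' | st' <- kids st] else 1.

Fixpoint layers_word (Ls : seq (seq nat)) : seq nat :=
  if Ls is l :: Ls' then layers_word Ls' ++ l else [::].

(** [Z] collects all that stands to the right, so that each layer is compared with the later layers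
    and with the rest of the word at once. *)
Fixpoint layered (Ls : seq (seq nat)) (Z : seq nat) : bool :=
  if Ls is l :: Ls' then
    [&& l != [::], pairwise gtn l, allrel ltn l Z & layered Ls' (l ++ Z)]
  else true.

(** A single letter of [B] lies below all of [D1]. This form passes to suffixes of [D1] and survives
    a new maximum in front, and the same letter shows that no suffix ending in [D1] can be kept. *)
Definition closed_shape Ls D1 D2 B :=
  [&& layered Ls (D1 ++ D2 ++ B), pairwise gtn (D1 ++ D2), allrel ltn D2 B,
      D1 != [::] & has (fun b => all (ltn b) D1) B].

(** The bound on the letters makes [size w] a legitimate new maximum. The trailing [[::]] in the
    [Open] case is the empty [B] of [node]. *)
Definition represents (w : seq nat) (st : state) : Prop :=
  all (gtn (size w)) w /\
  match st with
  | Open c m => exists A Ls l,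
      [/\ w = A ++ (layers_word Ls ++ l) ++ [::], node A (layers_word Ls ++ l) [::],
          layered (l :: Ls) [::], c = map size Ls & m.+1 = size l]
  | Closed c s r => exists A Ls D1 D2 B,
      [/\ w = A ++ (layers_word Ls ++ D1 ++ D2) ++ B,
          node A (layers_word Ls ++ D1 ++ D2) B, closed_shape Ls D1 D2 B &
          [/\ c = map size Ls, s = size D1 & r = size D2]]
  end.

Lemma layered_lt Ls Z : layered Ls Z -> allrel ltn (layers_word Ls) Z.
Proof.
elim: Ls Z => [//|l Ls IH] Z /= /and4P[_ _ hl /IH].
by rewrite allrel_catl allrel_catr hl => /andP[_ ->].
Qed.

Lemma layered_sub Ls Z Z' :
  layered Ls Z -> allrel ltn (layers_word Ls) Z' -> layered Ls Z'.
Proof.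
elim: Ls Z Z' => [//|l Ls IH] Z Z' /= /and4P[-> -> _ hL].
rewrite allrel_catl => /andP[h1 h2]; rewrite h2 (IH _ _ hL) //.
by have := layered_lt hL; rewrite !allrel_catr h1 => /andP[->].
Qed.

Lemma pairwise_gtn_geq s : pairwise gtn s -> pairwise geq s.
Proof. by apply: sub_pairwise => x y /ltnW. Qed.

Lemma allrel_ltn_leq s t : allrel ltn s t -> allrel leq s t.
Proof. by move=> /allrelP h; apply/allrelP => x y xs yt; apply: ltnW; apply: h. Qed.

Lemma insert_lt_size w l r :
  all (gtn (size w)) w -> l ++ r = w ->
  all (gtn (size (l ++ size w :: r))) (l ++ size w :: r).
Proof.
move=> h e; move: h; rewrite -{2}e !all_cat /= size_cat /= addnS -size_cat e => /andP[hl hr].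
rewrite /gtn /= ltnSn /=; apply/andP; split.
  by apply: sub_all hl => x /ltnW; rewrite /gtn /= ltnS.
by apply: sub_all hr => x /ltnW; rewrite /gtn /= ltnS.
Qed.

(** This is [node_insert] with [L] the surviving layers and [R = D1 ++ D2]: [X] joins [A], [Y] joins
    [B], and the maximum heads the new [D1]. Here [D1] may be empty before the insertion. *)
Lemma represents_Closed_insert A X Ls D1 D2 Y B W l r w st :
  w = A ++ W ++ B -> W = X ++ layers_word Ls ++ (D1 ++ D2) ++ Y ->
  node A W B -> all (gtn (size w)) w ->
  layered Ls (D1 ++ D2 ++ Y ++ B) -> pairwise gtn (D1 ++ D2) ->
  allrel ltn D2 (Y ++ B) -> has (fun b => all (ltn b) D1) (Y ++ B) ->
  (forall X0 x, X = rcons X0 x -> has (gtn x) (D1 ++ D2 ++ Y ++ B)) ->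
  (forall y Y0, Y = y :: Y0 -> has (gtn y) (D1 ++ D2)) ->
  l = A ++ X ++ layers_word Ls -> r = D1 ++ D2 ++ Y ++ B ->
  st = Closed (map size Ls) (size D1).+1 (size D2) ->
  represents (l ++ size w :: r) st.
Proof.
move=> ew eW nd ltw hLs hD hD2 hb hX hY el er ->.
have elr : l ++ r = w by rewrite ew eW el er -!catA.
split; first exact: insert_lt_size.
exists (A ++ X), Ls, (size w :: D1), D2, (Y ++ B); split=> //.
- by rewrite el er -!catA.
- have := @node_insert A X (layers_word Ls) (D1 ++ D2) Y B (size w).
  apply=> //; rewrite -?eW -?ew -?catA //.
  + by apply: allrel_ltn_leq; apply: layered_lt.
  + exact: pairwise_gtn_geq.
- have : all (gtn (size w)) (l ++ r) by rewrite elr.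
  rewrite el er !all_cat -!andbA => /and5P[_ _ ltL lt1 /and3P[lt2 ltY ltB]].
  rewrite /closed_shape /= hD hD2 all_cat lt1 lt2 /=; apply/andP; split.
    apply: (layered_sub hLs); rewrite allrel_consr ltL.
    exact: layered_lt.
  have /hasP[b bYB hbD] := hb; apply/hasP; exists b => //=; rewrite hbD andbT.
  by move: bYB; rewrite mem_cat => /orP[/(allP ltY)|/(allP ltB)].
Qed.

Lemma represents_Open_insert A X Ls d W l r w st :
  w = A ++ W ++ [::] -> W = X ++ layers_word Ls ++ d ->
  node A W [::] -> all (gtn (size w)) w ->
  layered Ls d -> pairwise gtn d ->
  (forall X0 x, X = rcons X0 x -> has (gtn x) d) ->
  l = A ++ X ++ layers_word Ls -> r = d ->
  st = Open (map size Ls) (size d) ->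
  represents (l ++ size w :: r) st.
Proof.
move=> ew eW nd ltw hLs hd hX el er ->.
have elr : l ++ r = w by rewrite ew eW el er -!catA cats0.
split; first exact: insert_lt_size.
exists (A ++ X), Ls, (size w :: d); split=> //.
- by rewrite el er -!catA cats0.
- have := @node_insert A X (layers_word Ls) d [::] [::] (size w).
  rewrite !cats0 /= -eW; apply=> //.
  + by move: ltw; rewrite {2}ew cats0.
  + by apply: allrel_ltn_leq; apply: layered_lt.
  + exact: pairwise_gtn_geq.
- have : all (gtn (size w)) (l ++ r) by rewrite elr.
  rewrite el er !all_cat -!andbA => /and4P[_ _ ltL ltd].
  rewrite /= ltd hd allrel0r cats0 /=.
  apply: (layered_sub hLs); rewrite allrel_consr ltL.
  exact: layered_lt.
Qed.

(** * Sums over the children of a represented word *)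

Section KidSums.

Variables (F : seq nat -> nat) (G : state -> nat).
Hypothesis FG : forall w st, represents w st -> F w = G st.

Definition site_sum (M : nat) (ps : seq (seq nat * seq nat)) : nat :=
  sumn [seq F (p.1 ++ M :: p.2) | p <- ps].

Lemma site_sum_cat M ps qs : site_sum M (ps ++ qs) = site_sum M ps + site_sum M qs.
Proof. by rewrite /site_sum map_cat sumn_cat. Qed.

Definition tree_sum (sts : seq state) : nat := sumn [seq G st | st <- sts].

Lemma tree_sum_cat ss ss' : tree_sum (ss ++ ss') = tree_sum ss + tree_sum ss'.
Proof. by rewrite /tree_sum map_cat sumn_cat. Qed.

(** Strictly inside a decreasing run, the letter left of the site exceeds the one to its right, so
    no layer survives. The rest of the run lies below what follows, so it becomes [D2], and the
    maximum alone is [D1]. This serves both for layers and for [D2]. *)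
Lemma run_site_sum A P l1 l2 Y B W w :
  w = A ++ W ++ B -> W = P ++ (l1 ++ l2) ++ Y -> node A W B -> all (gtn (size w)) w ->
  l1 != [::] -> pairwise gtn (l1 ++ l2) -> allrel ltn (l1 ++ l2) (Y ++ B) ->
  Y ++ B != [::] ->
  site_sum (size w) (splits (A ++ P ++ l1) l2 (Y ++ B)) =
  tree_sum [seq Closed [::] 1 j | j <- down (size l2)].
Proof.
move=> ew + nd ltw; elim: l2 l1 => [//|x l2 IH] l1 eW l1n hd hlt hn /=.
rewrite /site_sum /= (@FG _ (Closed [::] 1 (size l2).+1)); last first.
  apply: (@represents_Closed_insert A (P ++ l1) [::] [::] (x :: l2) Y B W _ _ w) => //.
  - by rewrite eW -!catA.
  - by move: hd; rewrite pairwise_cat => /and3P[].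
  - by move: hlt; rewrite allrel_catl => /andP[].
  - by case: (Y ++ B) hn.
  - move=> X0 y e; apply/hasP; exists x; rewrite ?mem_head //.
    case/lastP: l1 l1n hd e {eW hlt} => [//|l1 z] _ hd; rewrite -rcons_cat => /rcons_inj[_ <-].
    move: hd; rewrite pairwise_cat => /and3P[/allrelP/(_ z x)].
    by rewrite mem_rcons !mem_head => /(_ isT isT).
  - move=> y Y0 e; apply/hasP; exists x; rewrite ?mem_head //.
    move: hlt => /allrelP/(_ x y); rewrite e mem_cat !mem_head orbT => /(_ isT isT).
    by [].
  - by rewrite /= cats0.
congr (_ + _); have := IH (rcons l1 x); rewrite cat_rcons -!rcons_cat; apply=> //.
by case: (l1).
Qed.

Lemma layer_site_sum A Ls Y B W w :
  w = A ++ W ++ B -> W = layers_word Ls ++ Y -> node A W B -> all (gtn (size w)) w ->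
  layered Ls (Y ++ B) -> Y ++ B != [::] ->
  site_sum (size w) (splits A (layers_word Ls) (Y ++ B)) =
  tree_sum (layer_kids (map size Ls)).
Proof.
move=> ew + nd ltw; elim: Ls Y => [//|l Ls IH] Y /= eW /and4P[ln hd hlt hLs] hn.
rewrite splits_cat site_sum_cat tree_sum_cat -(IH (l ++ Y)) -?catA //; last first.
- by case: (l) ln.
- by rewrite eW -catA.
congr (_ + _); case: l ln hd hlt hLs eW => [//|x l] _ hd hlt hLs eW /=.
rewrite /site_sum /tree_sum /= (@FG _ (Closed (map size Ls) 1 (size l).+1)); last first.
  apply: (@represents_Closed_insert A [::] Ls [::] (x :: l) Y B W _ _ w) => //.
  - by rewrite eW -!catA.
  - by case: (Y ++ B) hn.
  - by case.
  - move=> y Y0 e; apply/hasP; exists x; rewrite ?mem_head //.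
    by move: hlt => /allrelP/(_ x y); rewrite e /= !mem_head => /(_ isT isT).
congr (_ + _); rewrite -cats1 -catA.
apply: (@run_site_sum A (layers_word Ls) [:: x] l Y B W) => //.
by rewrite eW -!catA.
Qed.

Lemma sum_down_shift (T : Type) (f : nat -> T) n :
  [seq f j.+1 | j <- down n] ++ [:: f 1] = [seq f j | j <- down n.+1].
Proof. by elim: n => [//|n IH] /=; rewrite IH. Qed.

Lemma closed_kids_sum A Ls D1 D2 B W w :
  w = A ++ W ++ B -> W = layers_word Ls ++ D1 ++ D2 -> node A W B -> all (gtn (size w)) w ->
  closed_shape Ls D1 D2 B ->
  site_sum (size w) (rcons (splits A W B) (A ++ W, B)) =
  tree_sum (kids (Closed (map size Ls) (size D1) (size D2))).
Proof.
move=> ew eW nd ltw /and5P[hLs hD hD2 D1n hb].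
have Bn : B != [::] by case: (B) hb.
(* After a nonempty part [d1] of [D1], the letter of [B] below [D1] rules out every suffix to the
   left, hence the empty list of layers. *)
have big d1 d2 : D1 = d1 ++ d2 -> d1 != [::] ->
    F ((A ++ layers_word Ls ++ d1) ++ size w :: d2 ++ D2 ++ B) =
    G (Closed [::] (size d2).+1 (size D2)).
  move=> e d1n; apply: FG.
  apply: (@represents_Closed_insert A (layers_word Ls ++ d1) [::] d2 D2 [::] B W _ _ w) => //.
  - by rewrite eW e cats0 -!catA.
  - by move: hD; rewrite e -catA pairwise_cat => /and3P[].
  - by apply: sub_has hb => b; rewrite e all_cat => /andP[].
  - have /hasP[b bB hbD] := hb.
    move=> X0 y e'; apply/hasP; exists b; first by rewrite !mem_cat bB !orbT.
    apply: (allP hbD); rewrite e mem_cat.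
    case/lastP: d1 d1n e e' => [//|d1 z] _ _; rewrite -rcons_cat => /rcons_inj[_ <-].
    by rewrite mem_rcons mem_head.
  - by rewrite /= cats0.
have big_sum d1 d2 : D1 = d1 ++ d2 -> d1 != [::] ->
    site_sum (size w) (splits (A ++ layers_word Ls ++ d1) d2 (D2 ++ B)) =
    tree_sum [seq Closed [::] j.+1 (size D2) | j <- down (size d2)].
  elim: d2 d1 => [//|x d2 IH] d1 e d1n.
  rewrite /site_sum /= -[x :: d2 ++ _]/((x :: d2) ++ _) big //; congr (_ + _).
  rewrite !rcons_cat; apply: IH; first by rewrite cat_rcons.
  by case: (d1).
rewrite -cats1 site_sum_cat {1}eW !splits_cat !site_sum_cat.
rewrite /kids (@layer_site_sum A Ls (D1 ++ D2) B W) //; last first.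
- by case: (D1) D1n.
- by rewrite -catA.
(* The site between [D1] and [D2] completes the list of labels down to 1. It is the first split of a
   nonempty [D2], but the final extra split when [D2] is empty, so it is counted here before the two
   cases are separated. *)
have bigs : site_sum (size w) (splits (A ++ layers_word Ls) D1 (D2 ++ B)) +
    F ((A ++ layers_word Ls ++ D1) ++ size w :: D2 ++ B) =
    tree_sum (Closed (map size Ls) (size D1).+1 (size D2) ::
      [seq Closed [::] j (size D2) | j <- down (size D1)]).
  rewrite (big D1 [::]) ?cats0 //.
  case: D1 D1n hLs hD hb eW big big_sum => [//|x D1] _ hLs hD hb eW big big_sum.
  rewrite -[size (x :: D1)]/(size D1).+1 -sum_down_shift -(cat1s (Closed _ _ _)) !tree_sum_cat /tree_sum /= !addn0.
  rewrite /site_sum /= (@FG _ (Closed (map size Ls) (size D1).+2 (size D2))); last first.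
    apply: (@represents_Closed_insert A [::] Ls (x :: D1) D2 [::] B W _ _ w) => //.
    - by rewrite eW cats0.
    - by case.
  by rewrite -addnA; congr (_ + (_ + _)); rewrite -cats1 -catA; apply: (big_sum [:: x]).
rewrite tree_sum_cat -cat_cons tree_sum_cat -bigs -!addnA; congr (_ + (_ + _)).
case: D2 hLs hD hD2 eW big {bigs big_sum} => [|y D2] hLs hD hD2 eW big.
  by rewrite /site_sum /= eW cats0 addn0.
rewrite {1}/site_sum /= -addnA; congr (_ + _); first by rewrite -!catA.
rewrite tree_sum_cat; congr (_ + _).
  rewrite -cats1 -!catA (catA (layers_word Ls)).
  apply: (@run_site_sum A (layers_word Ls ++ D1) [:: y] D2 [::] B W) => //.
  - by rewrite eW cats0 -catA.
  - by move: hD; rewrite pairwise_cat => /and3P[].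
(* At the end of the factor, [D2] lies below [B] and survives as one layer, while the last letter of
   [D1] stops the suffix. *)
rewrite /site_sum /tree_sum /= !addn0; apply: FG.
apply: (@represents_Closed_insert A (layers_word Ls ++ D1) [:: y :: D2] [::] [::] [::] B W _ _ w) => //.
- by rewrite eW /= cats0 -catA.
- move: hD; rewrite pairwise_cat => /and3P[_ _ hD].
  by apply/and4P; split.
- by case: (B) Bn.
- have /hasP[b bB hbD] := hb.
  move=> X0 z e'; apply/hasP; exists b; first by [].
  apply: (allP hbD).
  case/lastP: (D1) D1n e' => [//|d1 z'] _; rewrite -rcons_cat => /rcons_inj[_ <-].
  by rewrite mem_rcons mem_head.
- by rewrite /= eW -!catA.
Qed.

Lemma open_run_site_sum A P l1 l2 W w :
  w = A ++ W ++ [::] -> W = P ++ l1 ++ l2 -> node A W [::] -> all (gtn (size w)) w ->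
  l1 != [::] -> pairwise gtn (l1 ++ l2) ->
  site_sum (size w) (splits (A ++ P ++ l1) l2 [::]) =
  tree_sum [seq Open [::] j | j <- down (size l2)].
Proof.
move=> ew + nd ltw; elim: l2 l1 => [//|x l2 IH] l1 eW l1n hd /=.
rewrite /site_sum /= (@FG _ (Open [::] (size l2).+1)); last first.
  apply: (@represents_Open_insert A (P ++ l1) [::] (x :: l2) W _ _ w) => //.
  - by rewrite eW -!catA.
  - by move: hd; rewrite pairwise_cat => /and3P[].
  - move=> X0 y e; apply/hasP; exists x; rewrite ?mem_head //.
    case/lastP: l1 l1n hd e {eW} => [//|l1 z] _ hd; rewrite -rcons_cat => /rcons_inj[_ <-].
    move: hd; rewrite pairwise_cat => /and3P[/allrelP/(_ z x)].
    by rewrite mem_rcons !mem_head => /(_ isT isT).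
  - by rewrite /= cats0.
  - by rewrite cats0.
congr (_ + _); have := IH (rcons l1 x); rewrite cat_rcons -!rcons_cat; apply=> //.
by case: (l1).
Qed.

Lemma open_kids_sum A Ls l W w m :
  w = A ++ W ++ [::] -> W = layers_word Ls ++ l -> node A W [::] -> all (gtn (size w)) w ->
  layered (l :: Ls) [::] -> m.+1 = size l ->
  site_sum (size w) (rcons (splits A W [::]) (A ++ W, [::])) =
  tree_sum (kids (Open (map size Ls) m)).
Proof.
move=> ew eW nd ltw hLl em; have /= /and4P[ln hd _ hLs] := hLl.
rewrite cats0 in hLs.
rewrite -cats1 site_sum_cat {1}eW splits_cat site_sum_cat.
rewrite /kids (@layer_site_sum A Ls l [::] W) ?cats0 //; last by rewrite ew cats0.
rewrite tree_sum_cat -!addnA; congr (_ + _).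
case: l ln hd hLs eW em hLl => [//|x l] _ hd hLs eW [em] hLl.
rewrite {1}/site_sum /= (@FG _ (Open (map size Ls) m.+1)); last first.
  apply: (@represents_Open_insert A [::] Ls (x :: l) W _ _ w) => //.
  - by case.
  - by rewrite cats0.
  - by rewrite em.
rewrite -addnA /tree_sum /=; congr (_ + _); rewrite -/(tree_sum _) tree_sum_cat; congr (_ + _).
  rewrite em -cats1 -catA.
  by apply: (@open_run_site_sum A (layers_word Ls) [:: x] l W).
rewrite /site_sum /tree_sum /= !addn0; apply: FG.
apply: (@represents_Open_insert A [::] ((x :: l) :: Ls) [::] W _ _ w) => //.
- by rewrite eW /= cats0.
- by case.
- by rewrite eW.
- by rewrite /= em.
Qed.

(** With [word_count k] for [F] and [tree_count k] for [G], this is the induction step from [k] to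
    [k.+1]. *)
Lemma word_kids_sum w st : represents w st ->
  sumn [seq F w' | w' <- word_kids w] = tree_sum (kids st).
Proof.
case: st => [c m|c s r] [ltw].
  case=> [A [Ls [l [ew nd hL -> em]]]].
  rewrite {1}ew (word_kids_node nd) -map_comp -ew.
  exact: (open_kids_sum ew erefl nd ltw hL em).
case=> [A [Ls [D1 [D2 [B [ew nd sh [-> -> ->]]]]]]].
rewrite {1}ew (word_kids_node nd) -map_comp -ew.
exact: (closed_kids_sum ew erefl nd ltw sh).
Qed.

End KidSums.

Lemma word_count_tree k w st : represents w st -> word_count k w = tree_count k st.
Proof. by elim: k w st => [//|k IH] w st /= /(word_kids_sum IH). Qed.

Lemma represents_singleton : represents [:: 0] (Open [::] 0).
Proof.
split=> //; exists [::], [::], [:: 0]; split=> //.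
move=> l r /(congr1 size); rewrite size_cat /= => sz.
by rewrite /active !(@has_subseq_short _ 3) //; try lia; case=> [|a [|b [|c [|d t]]]].
Qed.

(** * Exhaustive generation of the avoiding words *)

Lemma good_short w : size w < 4 -> good w.
Proof.
move=> lt; rewrite /good !(@has_subseq_short _ 4) //;
  by case=> [|a [|b [|c [|d [|e t]]]]].
Qed.

Fixpoint words (n : nat) : seq (seq nat) :=
  if n is n'.+1 then flatten [seq word_kids w | w <- words n'] else [:: [::]].

Lemma mem_words n w : (w \in words n) = perm_eq w (iota 0 n) && good w.
Proof.
elim: n w => [|n IH] w.
  rewrite inE; case: w => [|x w] /=; first by rewrite good_short.
  by apply/esym/negP => /andP[/perm_size].
have iotaE : (perm_eq (T:=nat))^~ (iota 0 n.+1) =1 (perm_eq (T:=nat))^~ (n :: iota 0 n).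
  by apply/permPr; rewrite -addn1 iotaD /= add0n cats1 perm_rcons.
have ltn_n v : perm_eq v (iota 0 n) -> size v = n /\ all (gtn n) v.
  move=> pv; rewrite (perm_size pv) size_iota; split=> //.
  by apply/allP => x; rewrite (perm_mem pv) mem_iota.
apply/flatten_mapP/andP => [[v]|[]].
  rewrite IH => /andP[pv gv] /mapP[p]; rewrite mem_filter => /andP[act _] ->.
  have [szv ltv] := ltn_n _ pv; rewrite szv; split.
    by rewrite iotaE perm_catC /= perm_cons perm_catC cat_take_drop.
  by rewrite good_insert cat_take_drop // gv.
move=> pw gw.
have nw : n \in w by rewrite (perm_mem pw) mem_iota /= add0n.
case/splitPr: nw pw gw => l r pw gw.
have pv : perm_eq (l ++ r) (iota 0 n).
  by rewrite iotaE -cat1s perm_catCA perm_cons in pw.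
have [szv ltv] := ltn_n _ pv.
move: gw; rewrite good_insert // => /andP[gv act].
exists (l ++ r); first by rewrite IH pv gv.
apply/mapP; exists (size l); last by rewrite take_size_cat // drop_size_cat // szv.
by rewrite mem_filter take_size_cat // drop_size_cat // act mem_iota /= size_cat; lia.
Qed.

Lemma uniq_flatten_map (T U : eqType) (f : T -> seq U) (h : U -> T) (s : seq T) :
  uniq s -> (forall x, x \in s -> uniq (f x)) ->
  (forall x y, x \in s -> y \in f x -> h y = x) -> uniq (flatten [seq f x | x <- s]).
Proof.
elim: s => [//|x s IH] /= /andP[xs us] uf hf.
rewrite cat_uniq uf ?mem_head //= IH //; last first.
- by move=> y z ys; apply: hf; rewrite inE ys orbT.
- by move=> y ys; apply: uf; rewrite inE ys orbT.
rewrite andbT; apply/hasPn => y /flatten_mapP[z zs yz]; apply/negP => yx.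
by move: xs; rewrite -(hf x y (mem_head _ _) yx) (hf z y _ yz) ?zs // inE zs orbT.
Qed.

(** Erasing the letter [n] recovers the parent, which separates the blocks of children; the position
    of [n] recovers the site, which separates the children of one parent. *)
Lemma words_uniq n : uniq (words n).
Proof.
elim: n => [//|n IH] /=.
have fresh w : w \in words n -> size w = n /\ n \notin w.
  rewrite mem_words => /andP[pw _]; rewrite (perm_size pw) size_iota; split=> //.
  by rewrite (perm_mem pw) mem_iota /= add0n ltnn.
apply: (@uniq_flatten_map _ _ _ (filter (predC1 n))) => // [w|w v] /fresh[szw nw].
  apply: (@map_uniq _ _ (index n)); rewrite -map_comp map_id_in ?filter_uniq ?iota_uniq //.
  move=> p; rewrite mem_filter mem_iota => /andP[_ /= ltp].
  rewrite szw index_cat (negbTE (contra (@mem_take _ _ _ _) nw)) /= eqxx addn0 size_takel //.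
move=> /mapP[p _ ->]; rewrite szw filter_cat /= eqxx /= -filter_cat cat_take_drop.
by apply/all_filterP/allP => x xw /=; apply: contraNneq nw => <-.
Qed.

Lemma size_words k n : size (words (k + n)) = sumn [seq word_count n w | w <- words k].
Proof.
elim: n k => [|n IH] k.
  by rewrite addn0 /=; elim: (words k) => //= w s ->.
rewrite addnS -addSn IH /=.
by elim: (words k) => [//|w s IHs] /=; rewrite map_cat sumn_cat IHs.
Qed.

(** * Permutations as words *)

Section PermWord.

Variable n : nat.
Implicit Types s : 'S_n.

Definition perm_word s : seq nat := [seq val (s i) | i <- enum 'I_n].

Definition is_pat k (sigma : 'I_k -> nat) (t : seq nat) : bool :=
  (size t == k) &&
  [forall a : 'I_k, forall b : 'I_k, (nth 0 t a < nth 0 t b) == (sigma a < sigma b)].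

Lemma sorted_enum_ord k : sorted (fun i j : 'I_k => i < j) (enum 'I_k).
Proof. by have := iota_ltn_sorted 0 k; rewrite -val_enum_ord sorted_map. Qed.

Lemma contains_perm_word k (s : 'S_n) (sigma : 'I_k -> nat) :
  contains s sigma = has_subseq (is_pat sigma) (perm_word s).
Proof.
have tr k' : transitive (fun i j : 'I_k' => i < j) by move=> ? ? ?; apply: ltn_trans.
apply/existsP/has_subseqP => [[f /forallP fP]|[t]].
  pose u := [seq f a | a <- enum 'I_k].
  have su : subseq u (enum 'I_n).
    (* Both lists are strictly increasing with the same elements, so the image of [f] is a filter of
       the enumeration, hence a subsequence. *)
    have -> : u = [seq x <- enum 'I_n | x \in u].
      apply: (@irr_sorted_eq _ (fun i j : 'I_n => i < j) (tr n)) => //.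
      - exact: (fun i => ltnn i).
      - apply: homo_sorted (sorted_enum_ord k) => a b ab.
        by have /forallP/(_ b)/andP[/implyP/(_ ab)] := fP a.
      - exact: (sorted_filter (tr n) _ (sorted_enum_ord n)).
      - by move=> x; rewrite mem_filter mem_enum andbT.
    exact: filter_subseq.
  exists [seq val (s x) | x <- u]; first exact: map_subseq.
  have szu : size u = k by rewrite size_map size_enum_ord.
  have nthE (c : 'I_k) : nth 0 [seq val (s x) | x <- u] c = s (f c).
    by rewrite (nth_map (f c)) ?szu // (nth_map c) ?size_enum_ord // nth_ord_enum.
  rewrite /is_pat size_map szu eqxx /=.
  apply/forallP => a; apply/forallP => b.
  have /forallP/(_ b)/andP[_] := fP a.
  by rewrite !nthE.
case/subseqP => m _ ->; rewrite -map_mask; set u := mask m _.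
case/andP; rewrite size_map => szu /forallP uP.
pose f := [ffun a => tnth (Tuple szu) a]; exists f.
apply/forallP => a; apply/forallP => b.
have nthE (c : 'I_k) x0 : nth x0 u c = f c by rewrite ffunE (tnth_nth x0).
have ltu (c : 'I_k) : c < size u by rewrite (eqP szu).
have /forallP/(_ b) := uP a; rewrite !(nth_map (f a)) // !nthE => ->; rewrite andbT.
apply/implyP => ab; rewrite -(nthE a (f a)) -(nthE b (f a)).
apply: (sorted_ltn_nth (tr n)) => //; rewrite ?inE //.
by apply: sorted_mask => //; apply: sorted_enum_ord.
Qed.

Lemma perm_word_inj : injective perm_word.
Proof.
move=> s1 s2 /eq_in_map e; apply/permP => i; apply: val_inj.
by apply: e; rewrite mem_enum.
Qed.

Lemma perm_word_perm_eq s : perm_eq (perm_word s) (iota 0 n).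
Proof.
apply: uniq_perm; rewrite ?iota_uniq //.
  by rewrite map_inj_uniq ?enum_uniq // => i j /val_inj/perm_inj.
move=> x; rewrite mem_iota /= add0n; apply/mapP/idP => [[i _ ->]|ltx]; first exact: ltn_ord.
by exists (s^-1%g (Ordinal ltx)); rewrite ?mem_enum ?permKV.
Qed.

Lemma perm_word_onto w : perm_eq w (iota 0 n) -> exists s, perm_word s = w.
Proof.
move=> pw; have szw : size w = n by rewrite (perm_size pw) size_iota.
have lt (i : 'I_n) : nth 0 w i < n.
  have : nth 0 w i \in w by rewrite mem_nth // szw.
  by rewrite (perm_mem pw) mem_iota.
have inj : injective (fun i => Ordinal (lt i)).
  move=> i j [] /eqP; rewrite nth_uniq ?szw // ?(perm_uniq pw) ?iota_uniq //.
  by move/eqP/val_inj.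
exists (perm inj); apply: (@eq_from_nth _ 0); rewrite size_map size_enum_ord // => i ltin.
by rewrite (nth_map (Ordinal ltin)) ?size_enum_ord // permE /= nth_enum_ord.
Qed.

End PermWord.

Lemma is_pat4231 : is_pat pat4231 =1 is4231.
Proof.
case=> [|a [|b [|c [|d [|e t]]]]] //=; rewrite /is_pat /=.
apply/forallP/idP => [h|h [i lti]]; last first.
  apply/forallP => -[j ltj]; move: h.
  case: i lti => [|[|[|[|i]]]] // lti; case: j ltj => [|[|[|[|j]]]] // ltj;
  rewrite /pat4231 /= ?ltnn //; lia.
(* The positions 3, 1, 2, 0 list the pattern by increasing value, which gives the chain
   [d < b < c < a]. *)
have /forallP/(_ (@Ordinal 4 1 isT)) := h (@Ordinal 4 3 isT).
have /forallP/(_ (@Ordinal 4 2 isT)) := h (@Ordinal 4 1 isT).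
have /forallP/(_ (@Ordinal 4 0 isT)) := h (@Ordinal 4 2 isT).
by rewrite /pat4231 /=; lia.
Qed.

Lemma is_pat3124 : is_pat pat3124 =1 is3124.
Proof.
case=> [|a [|b [|c [|d [|e t]]]]] //=; rewrite /is_pat /=.
apply/forallP/idP => [h|h [i lti]]; last first.
  apply/forallP => -[j ltj]; move: h.
  case: i lti => [|[|[|[|i]]]] // lti; case: j ltj => [|[|[|[|j]]]] // ltj;
  rewrite /pat3124 /= ?ltnn //; lia.
have /forallP/(_ (@Ordinal 4 2 isT)) := h (@Ordinal 4 1 isT).
have /forallP/(_ (@Ordinal 4 0 isT)) := h (@Ordinal 4 2 isT).
have /forallP/(_ (@Ordinal 4 3 isT)) := h (@Ordinal 4 0 isT).
by rewrite /pat3124 /=; lia.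
Qed.

Lemma eq_has_subseq P Q w : P =1 Q -> has_subseq P w = has_subseq Q w.
Proof. by move=> e; apply: eq_existsb => m. Qed.

Lemma good_perm_word n (s : 'S_n) :
  good (perm_word s) = avoids s pat4231 && avoids s pat3124.
Proof.
by rewrite /avoids !contains_perm_word (eq_has_subseq _ is_pat4231) (eq_has_subseq _ is_pat3124).
Qed.

Lemma av_count_words n : av_count n = size (words n).
Proof.
rewrite /av_count cardE -(size_map (@perm_word n)); apply: perm_size.
apply: uniq_perm; rewrite ?words_uniq // ?map_inj_uniq ?enum_uniq //; first exact: perm_word_inj.
move=> w; rewrite mem_words; apply/mapP/andP => [[s]|[pw gw]].
  by rewrite mem_enum inE -good_perm_word => gs ->; split=> //; apply: perm_word_perm_eq.
have [s es] := perm_word_onto pw; exists s => //.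
by rewrite mem_enum inE -good_perm_word es.
Qed.

Lemma av_count_tree n : av_count n.+1 = tree_count n (Open [::] 0).
Proof.
rewrite av_count_words -add1n size_words.
have -> : words 1 = [:: [:: 0]].
  apply: perm_small_eq => //; apply: uniq_perm; rewrite ?words_uniq // => w.
  rewrite mem_words inE; apply/andP/eqP => [[pw _]|->]; last by rewrite good_short.
  by apply: perm_small_eq.
by rewrite /= addn0; apply: word_count_tree; apply: represents_singleton.
Qed.

(* Imported only here: Coquelicot shadows [iota]. *)
From Stdlib Require Import Reals Lra.
From Coquelicot Require Import Coquelicot.
Open Scope R_scope.

(** * Finite real sums over lists *)

Section ListSums.
Variable T : Type.
Implicit Types (f g : T -> R) (l : seq T).

Fixpoint rsum f l : R := if l is a :: l' then f a + rsum f l' else 0.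

Lemma rsum_cat f l1 l2 : rsum f (l1 ++ l2) = rsum f l1 + rsum f l2.
Proof. elim: l1 => [|a l IH] /=; [ring | rewrite IH; ring]. Qed.

Lemma eq_rsum f g l : f =1 g -> rsum f l = rsum g l.
Proof. by move=> e; elim: l => [//|a l IH] /=; rewrite IH e. Qed.

Lemma rsum_sub f g l : rsum (fun a => f a - g a) l = rsum f l - rsum g l.
Proof. elim: l => [|a l IH] /=; [ring | rewrite IH; ring]. Qed.

Lemma rsum_scal (k : R) f l : rsum (fun a => k * f a) l = k * rsum f l.
Proof. elim: l => [|a l IH] /=; [ring | rewrite IH; ring]. Qed.

Lemma rsum_abs_le f g l :
  (forall a, Rabs (f a) <= g a) -> Rabs (rsum f l) <= rsum g l.
Proof.
move=> H; elim: l => [|a l IH] /=; first by rewrite Rabs_R0; lra.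
by have := Rabs_triang (f a) (rsum f l); have := H a; lra.
Qed.

Lemma INR_sumn (f : T -> nat) l :
  INR (sumn [seq f a | a <- l]) = rsum (fun a => INR (f a)) l.
Proof. by elim: l => [//|a l IH] /=; rewrite plus_INR IH. Qed.

End ListSums.

Lemma rsum_map (T U : Type) (h : T -> U) (f : U -> R) (l : seq T) :
  rsum f [seq h a | a <- l] = rsum (fun a => f (h a)) l.
Proof. by elim: l => [//|a l IH] /=; rewrite IH. Qed.

(** * Closed form of the generating functions of the labels *)

Section Candidate.

Variable t : R.

(* [x = t / (1+t)^2] makes [1 + t] the Catalan generating function of x. *)
Definition xt := t / (1 + t) ^ 2.
Definition rho := 1 + t + t ^ 2.

(** This is the sum of [state_gf] over [layer_kids c], as [rsum_layer_kids] confirms; it is set up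
    first because [state_gf] depends on it. *)
Fixpoint layers_gf (c : seq nat) : R :=
  if c is m :: c' then
    (1 + t / rho) * layers_gf c' + (1 + t) ^ 2 * (rho ^ m + rsum (pow rho) (down m.-1))
  else 0.

(* [beta], [kappa] and [mu] are determined by the equation of an [Open] label:
   [beta = x * (1 + 2 * beta + beta * t / rho)] collects the multiples of [layers_gf c],
   [kappa * (rho - 1) = x * kappa * rho^2 + x * beta * (1 + t)^2 * rho] those of [rho^m],
   and [mu] the constant term. *)
Definition beta := t * rho / (1 + t + t ^ 2 + t ^ 3 + t ^ 4).
Definition kappa :=
  rho ^ 2 * (1 + t) ^ 2 / ((1 + t + t ^ 2 + t ^ 3 + t ^ 4) * (1 - t ^ 2 - t ^ 3)).
Definition mu := 1 - kappa * (1 - xt * rho).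

Definition open_gf (m : nat) : R := mu * (1 + t) ^ m.+2 + kappa * rho ^ m.+1.

Definition state_gf (st : state) : R :=
  match st with
  | Open c m => open_gf m + beta * layers_gf c
  | Closed c s r => (1 + t) ^ s.+1 * rho ^ r + t / rho * layers_gf c
  end.

Hypothesis t_small : Rabs t <= / 10.

Lemma t_bounds : - / 10 <= t <= / 10.
Proof. by apply/Rabs_le_between. Qed.

Lemma rho_gt0 : 0 < rho. Proof. have := t_bounds; rewrite /rho => -[? ?]; nra. Qed.
Lemma den1_gt0 : 0 < 1 + t + t ^ 2 + t ^ 3 + t ^ 4.
Proof.
have [ht ht'] := t_bounds.
have -> : 1 + t + t ^ 2 + t ^ 3 + t ^ 4 = (1 + t) * (1 + t ^ 2) + (t ^ 2) ^ 2 by ring.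
have : 0 < (1 + t) * (1 + t ^ 2) by apply: Rmult_lt_0_compat; nra.
have := pow2_ge_0 (t ^ 2).
lra.
Qed.
Lemma den2_gt0 : 0 < 1 - t ^ 2 - t ^ 3.
Proof. case: t_bounds => ? ?; nra. Qed.

Lemma rsum_layer_kids c : rsum state_gf (layer_kids c) = layers_gf c.
Proof.
have h0 := rho_gt0.
elim: c => [//|m c IH] /=; rewrite rsum_cat /= IH rsum_map /=.
rewrite (_ : rsum _ _ = (1 + t) ^ 2 * rsum (pow rho) (down m.-1)); last first.
  by rewrite -rsum_scal; apply: eq_rsum => a /=; field; lra.
field; lra.
Qed.

(** The equation for the sites of [D2], after [xt] has cancelled the factor [(1 + t) ^ 2]. Passing
    from [r] to [r.+1] adds [(t + t ^ 2) * rho ^ r.+1] to the left side, and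
    [rho - 1 = t + t ^ 2]. *)
Lemma rho_geom r :
  1 + t + t * rsum (pow rho) (down r)
    + t ^ 2 / rho * (rho ^ r.+1 + rsum (pow rho) (down r)) = rho ^ r.+1.
Proof.
have h0 := rho_gt0.
elim: r => [|r IH] /=; first by transitivity (1 + t + t ^ 2); [field; lra | rewrite /rho; ring].
have e : rho * (rho * rho ^ r) - rho * rho ^ r = t * (rho * rho ^ r) + t ^ 2 * (rho * rho ^ r).
  by rewrite /rho; ring.
transitivity (rho ^ r.+1 + (t + t ^ 2) * rho ^ r.+1); last by rewrite /= ; lra.
rewrite -{1}IH /=; field; lra.
Qed.

Lemma state_gf_Closed c s r : state_gf (Closed c s r) = 1 + xt * rsum state_gf (kids (Closed c s r)).
Proof.
have h0 := rho_gt0; have [ht ht'] := t_bounds.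
rewrite /kids rsum_cat rsum_layer_kids /= rsum_cat !rsum_map /=.
have -> : rsum (fun a => (1 + t) * (1 + t) ^ a * rho ^ r + t / rho * 0) (down s)
   = rho ^ r * rsum (fun a => (1 + t) ^ a.+1) (down s).
  by rewrite -rsum_scal; apply: eq_rsum => a /=; field; lra.
(* The sites before and inside [D1]: the sum telescopes through [xt * (1 + t) ^ 2 = t]. *)
have cat_geom : xt * ((1 + t) ^ s.+2 + rsum (fun a => (1 + t) ^ a.+1) (down s)) = (1 + t) ^ s.+1 - 1.
  elim: s => [|s IH] /=; first by rewrite /xt; field; lra.
  transitivity ((1 + t) ^ s.+1 - 1 + xt * (1+t) ^ s.+3); first by rewrite -IH /=; ring.
  by rewrite /xt /=; field; lra.
have tail : 1 + xt * rsum state_gf (if r is r'.+1 then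
         [seq Closed [::] 1 j | j <- down r'] ++ [:: Closed [:: r] 1 0]
       else [::]) = rho ^ r.
  case: r => [|r] /=; first by ring.
  rewrite rsum_cat rsum_map /=.
  have -> : rsum (fun a => (1 + t) * ((1 + t) * 1) * rho ^ a + t / rho * 0) (down r)
      = (1 + t) ^ 2 * rsum (pow rho) (down r).
    by rewrite -rsum_scal; apply: eq_rsum => a /=; field; lra.
  rewrite -[RHS](rho_geom r) /= /xt; field; lra.
(* The layers enter the right side once through [layer_kids c] and [t / rho] times through
   [Closed c s.+1 r]. The balance amounts to [rho + t = (1 + t) ^ 2]. *)
have hx : xt * (1 + t / rho) = t / rho.
  rewrite /xt /rho; field; split; last by lra. rewrite /rho in h0; lra.
set U := rsum state_gf _ in tail *.
transitivity (rho ^ r + rho ^ r * ((1 + t) ^ s.+1 - 1) + t / rho * layers_gf c); first by rewrite /=; ring.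
by rewrite -{1}tail -cat_geom -{1}hx /=; ring.
Qed.

(** Subtracting the equations for [m.+1] and [m] cancels the sums and leaves a linear recurrence.
    Its homogeneous part is solved by powers of [1 + t] ([e1]), its [rho] part by the choice of
    [kappa] ([e2]); the base case fixes [mu]. *)
Lemma open_gf_rec m :
  open_gf m = 1 + xt * (open_gf m.+1 + rsum open_gf (down m) + open_gf 0
    + beta * (1 + t) ^ 2 * (rho ^ m.+1 + rsum (pow rho) (down m))).
Proof.
have [ht ht'] := t_bounds; have h0 := rho_gt0; have h1 := den1_gt0; have h2 := den2_gt0.
elim: m => [|m IH].
  by rewrite /open_gf /mu /kappa /beta /xt /= /rho in h0 *; field; repeat split; nra.
transitivity (open_gf m + (xt * open_gf m.+2 + xt * beta * (1 + t) ^ 2 * rho ^ m.+2)).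
  rewrite /open_gf /=.
  set a := (1 + t) ^ m; set b := rho ^ m.
  have e1 : (1 + t) * (1 + t) * (1 + t) - (1 + t) * (1 + t) = xt * ((1 + t) * ((1 + t) * ((1 + t) * (1 + t)))).
    by rewrite /xt; field; lra.
  have e2 : kappa * (rho * rho) - kappa * rho = xt * kappa * (rho * rho * rho) + xt * beta * (1 + t) ^ 2 * (rho * rho).
    by rewrite /kappa /beta /xt /= /rho in h0 *; field; repeat split; nra.
  transitivity (mu * a * ((1 + t) * (1 + t)) + kappa * rho * b + mu * a * ((1 + t) * (1 + t) * (1 + t) - (1 + t) * (1 + t))
     + b * (kappa * (rho * rho) - kappa * rho)); first by ring.
  by rewrite e1 e2 /=; ring.
rewrite {1}IH /=; ring.
Qed.

Lemma state_gf_Open c m : state_gf (Open c m) = 1 + xt * rsum state_gf (kids (Open c m)).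
Proof.
have [ht ht'] := t_bounds; have h0 := rho_gt0; have h1 := den1_gt0.
rewrite /kids rsum_cat rsum_layer_kids /= rsum_cat !rsum_map /=.
have -> : rsum (fun a => open_gf a + beta * 0) (down m) = rsum open_gf (down m).
  by apply: eq_rsum => a; ring.
rewrite open_gf_rec /=.
(* The multiples of [layers_gf c]: 1 from [layer_kids c], [beta] from [Open c m.+1], and
   [beta * (1 + t / rho)] from the child with a new layer. *)
have e : beta = xt * (1 + 2 * beta + beta * t / rho).
  by rewrite /beta /xt /rho in h0 *; field; repeat split; nra.
rewrite {2}e; field; lra.
Qed.

Lemma state_gf_kids st : state_gf st = 1 + xt * rsum state_gf (kids st).
Proof. case: st => [c m|c s r]; [exact: state_gf_Open | exact: state_gf_Closed]. Qed.


(** Since [s = (1 - t) / (1 + t)] and [x = t / (1 + t) ^ 2], both sides are rational functions of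
    [t], and the claim is an identity between them. *)
Lemma state_gf_root x s : s ^ 2 = 1 - 4 * x -> t = (1 - s) / (1 + s) -> 0 <= s -> Rabs x < / 100 ->
  x * state_gf (Open [::] 0) =
  (1 - 8*x + 20*x^2 - 20*x^3 + 10*x^4 - 2*x^5 - (1 - 4*x + 2*x^2) * s)
         / (2 * (1 - 3*x + x^2) * (-1 + 5*x - 4*x^2 + x^3)).
Proof.
move=> s2 et s0 /Rabs_def2 [x1 x2].
have [ht ht'] := t_bounds; have h1 := den1_gt0; have h2 := den2_gt0.
have es : s = (1 - t) / (1 + t) by rewrite et; field; lra.
have ex : x = t / (1 + t) ^ 2 by apply: (Rmult_eq_reg_l 4); [transitivity (1 - s ^ 2); [lra | rewrite es; field; lra] | lra].
have d1 : 1 - 3 * x + x ^ 2 <> 0 by nra.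
have d2 : -1 + 5 * x - 4 * x ^ 2 + x ^ 3 <> 0 by nra.
apply: (Rmult_eq_reg_r (2 * (1 - 3*x + x^2) * (-1 + 5*x - 4*x^2 + x^3))); last first.
  by repeat apply: Rmult_integral_contrapositive_currified => //; lra.
rewrite [RHS]Rmult_assoc Rinv_l; last first.
  by repeat apply: Rmult_integral_contrapositive_currified => //; lra.
rewrite /state_gf /open_gf /mu /kappa /xt /rho /= es ex; field; repeat split; nra.
Qed.

End Candidate.

(** * Exponential weights and convergence *)

(** The exponent [m.+1] leaves a factor 4 even for [m = 0], so the bound on [layer_kids] closes with
    a constant independent of the number of layers. *)
Fixpoint layer_weight (c : seq nat) : R :=
  if c is m :: c' then layer_weight c' * 4 ^ m.+1 else 1.

Definition weight (st : state) : R :=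
  match st with
  | Open c m => layer_weight c * 4 ^ m
  | Closed c s r => layer_weight c * 4 ^ s * 4 ^ r
  end.

Lemma layer_weight_ge1 c : 1 <= layer_weight c.
Proof.
elim: c => [|m c IH] /=; first by lra.
by have := pow_R1_Rle 4 m; nra.
Qed.

Lemma weight_ge1 st : 1 <= weight st.
Proof.
have h4 := pow_R1_Rle 4.
case: st => [c m|c s r] /=; have hc := layer_weight_ge1 c.
  by have := h4 m; nra.
have hs : 1 <= layer_weight c * 4 ^ s by have := h4 s; nra.
by have := h4 r; nra.
Qed.

Lemma rsum_pow4_down m : rsum (pow 4) (down m) <= 4 / 3 * 4 ^ m.
Proof. by elim: m => [|m IH] /=; lra. Qed.

Lemma rsum_pow4_down_pred m : rsum (pow 4) (down m.-1) <= / 3 * 4 ^ m.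
Proof.
case: m => [|m] /=; first by lra.
by have := rsum_pow4_down m; lra.
Qed.

Lemma layer_kids_weight c : rsum weight (layer_kids c) <= 3 * layer_weight c.
Proof.
elim: c => [|m c IH] /=; first by lra.
rewrite rsum_cat /= rsum_map.
rewrite (_ : rsum _ (down _) = 4 * rsum (pow 4) (down m.-1)); last first.
  by rewrite -rsum_scal; apply: eq_rsum => a /=; ring.
have := rsum_pow4_down_pred m; have := layer_weight_ge1 c.
have := pow_R1_Rle 4 m; nra.
Qed.

(** The largest share, 16 times the weight, can come from a child with a new layer; 32 leaves room
    for the others and keeps [32 * Rabs x < 1] for [Rabs x < / 100]. *)
Lemma kids_weight st : rsum weight (kids st) <= 32 * weight st.
Proof.
have h4 := pow_R1_Rle 4.
case: st => [c m|c s r]; rewrite /kids rsum_cat /= rsum_cat !rsum_map /=;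
  have hc := layer_weight_ge1 c; have hl := layer_kids_weight c.
  rewrite (_ : rsum _ (down m) = rsum (pow 4) (down m)); last first.
    by apply: eq_rsum => a /=; ring.
  have := rsum_pow4_down m; have := h4 m; nra.
rewrite (_ : rsum _ (down s) = 4 ^ r * rsum (pow 4) (down s)); last first.
  by rewrite -rsum_scal; apply: eq_rsum => a /=; ring.
have hr : 1 <= 4 ^ r by apply: h4; lra.
have hs : 1 <= 4 ^ s by apply: h4; lra.
have tail : rsum weight (if r is r'.+1 then
         [seq Closed [::] 1 j | j <- down r'] ++ [:: Closed [:: r] 1 0]
       else [::]) <= 18 * 4 ^ r.
  case: r {hr} => [|r] /=; first by lra.
  rewrite rsum_cat rsum_map /=.
  rewrite (_ : rsum _ (down r) = 4 * rsum (pow 4) (down r)); last first.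
    by rewrite -rsum_scal; apply: eq_rsum => a /=; ring.
  have := rsum_pow4_down r; have := h4 r; lra.
have hsr : 4 ^ r <= 4 ^ s * 4 ^ r by nra.
have hss : 4 ^ r * rsum (pow 4) (down s) <= 4 / 3 * (4 ^ s * 4 ^ r).
  by have := rsum_pow4_down s; nra.
have : 4 ^ s * 4 ^ r <= layer_weight c * (4 ^ s * 4 ^ r) by nra.
have : layer_weight c <= layer_weight c * (4 ^ s * 4 ^ r) by nra.
nra.
Qed.

Section Convergence.

Variables (t x : R).
Hypotheses (t_small : Rabs t <= / 10) (x_eq : x = xt t) (x_small : Rabs x < / 100).

(** The coefficients of [mu] and [kappa] come from [(1 + t) ^ 2 <= 4] and [rho <= 2], that of [beta]
    from [layers_gf_bound]; the plain constants cover the [Closed] case and the subtracted 1. *)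
Definition gf_bound := 2 + Rabs (mu t) * 4 + Rabs (kappa t) * 2 + 4 * Rabs (beta t) + 2 + 2.

Lemma rho_bounds : 9 / 10 <= rho t <= 2.
Proof. by rewrite /rho; have [? ?] := t_bounds t_small; split; nra. Qed.

Lemma rsum_rho_down m : rsum (pow (rho t)) (down m) + 2 <= 2 * 2 ^ m.
Proof.
elim: m => [|m IH] /=; first by lra.
have [r0 r1] := rho_bounds.
have : rho t * rho t ^ m <= 2 * 2 ^ m by apply: (pow_incr _ _ m.+1); lra.
lra.
Qed.

Lemma layers_gf_bound c : Rabs (layers_gf t c) <= 4 * layer_weight c.
Proof.
have [r0 r1] := rho_bounds; have [t0 t1] := t_bounds t_small.
elim: c => [|m c IH] /=; first by rewrite Rabs_R0; lra.
apply: Rle_trans (Rabs_triang _ _) _; rewrite !Rabs_mult.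
have h1 : Rabs (1 + t / rho t) <= 3 / 2.
  have e : t / rho t * rho t = t by field; lra.
  by apply/Rabs_le_between; nra.
have [p0 p1] : 0 <= rho t ^ m + rsum (pow (rho t)) (down m.-1) <= 2 * 2 ^ m.
  split.
    apply: Rplus_le_le_0_compat; first by apply: pow_le; lra.
    by elim: (down _) => [|a l IHl] /=; [lra | have := pow_le (rho t) a; lra].
  have := pow_incr (rho t) 2 m; case: m => [|m] /=; first by lra.
  by have := rsum_rho_down m; lra.
have h2 : Rabs (1 + t) * (Rabs (1 + t) * Rabs 1) <= 3 / 2.
  by rewrite Rabs_R1 Rabs_pos_eq; nra.
have h3 := layer_weight_ge1 c; have h4 : 1 <= 2 ^ m by apply: pow_R1_Rle; lra.
have h5 : 2 ^ m <= 4 ^ m by apply: pow_incr; lra.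
rewrite (Rabs_pos_eq _ p0).
have q1 : Rabs (1 + t / rho t) * Rabs (layers_gf t c) <= 3 / 2 * (4 * layer_weight c).
  by apply: Rmult_le_compat => //; apply: Rabs_pos.
have q2 : Rabs (1 + t) * (Rabs (1 + t) * Rabs 1) *
      (rho t ^ m + rsum (pow (rho t)) (down m.-1)) <= 3 / 2 * (2 * 2 ^ m).
  by apply: Rmult_le_compat => //; rewrite -Rabs_mult -Rabs_mult; apply: Rabs_pos.
nra.
Qed.

(** The 1 is the partial sum at level 0, so this is the base case of [partial_sum_error]. *)
Lemma state_gf_bound st : Rabs (state_gf t st - 1) <= gf_bound * weight st.
Proof.
have [r0 r1] := rho_bounds; have [t0 t1] := t_bounds t_small.
have hw := weight_ge1 st.
have hp k : 0 <= (1 + t) ^ k <= 4 ^ k by split; [apply: pow_le | apply: pow_incr]; lra.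
have hq k : 0 <= rho t ^ k <= 4 ^ k by split; [apply: pow_le | apply: pow_incr]; lra.
have m0 := Rabs_pos (mu t); have k0 := Rabs_pos (kappa t); have b0 := Rabs_pos (beta t).
apply: Rle_trans (Rabs_triang _ _) _; rewrite Rabs_Ropp Rabs_R1 /gf_bound.
case: st hw => [c m|c s r] /= hw.
  have hg := layers_gf_bound c; have hc := layer_weight_ge1 c.
  have h4 : 1 <= 4 ^ m by apply: pow_R1_Rle; lra.
  have a1 : Rabs (open_gf t m) <= (Rabs (mu t) * 4 + Rabs (kappa t) * 2) * 4 ^ m.
    rewrite /open_gf; apply: Rle_trans (Rabs_triang _ _) _;
    rewrite (Rabs_mult (mu t)) (Rabs_mult (kappa t)) -(RPow_abs (1 + t)) -(RPow_abs (rho t)) /=.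
    rewrite !(Rabs_pos_eq (1 + t)) ?(Rabs_pos_eq (rho t)); try lra.
    have u1 : (1 + t) * ((1 + t) * (1 + t) ^ m) <= 4 * 4 ^ m by rewrite -Rmult_assoc; apply: Rmult_le_compat; try nra; case: (hp m).
    have u2 : rho t * rho t ^ m <= 2 * 4 ^ m by have := hq m; nra.
    have := Rmult_le_compat_l _ _ _ m0 u1; have := Rmult_le_compat_l _ _ _ k0 u2; lra.
  have a2 : Rabs (beta t * layers_gf t c) <= 4 * Rabs (beta t) * layer_weight c.
    by rewrite Rabs_mult; nra.
  have := Rabs_triang (open_gf t m) (beta t * layers_gf t c).
  have : 4 ^ m <= layer_weight c * 4 ^ m by nra.
  have : layer_weight c <= layer_weight c * 4 ^ m by nra.
  set w := _ * _ in hw *; nra.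
have hg := layers_gf_bound c; have hc := layer_weight_ge1 c.
have h4 : 1 <= 4 ^ s by apply: pow_R1_Rle; lra.
have h5 : 1 <= 4 ^ r by apply: pow_R1_Rle; lra.
have u : (1 + t) * (1 + t) ^ s * rho t ^ r <= 2 * (4 ^ s * 4 ^ r).
  have : (1 + t) * (1 + t) ^ s <= 2 * 4 ^ s by have := hp s; nra.
  have := hp s; have := hq r; nra.
have u0 : 0 <= (1 + t) * (1 + t) ^ s * rho t ^ r.
  by repeat apply: Rmult_le_pos; try lra; case: (hp s) (hq r) => ? ? [].
have v : Rabs (t / rho t * layers_gf t c) <= 2 * layer_weight c.
  rewrite Rabs_mult; have : Rabs (t / rho t) <= / 2; last by have := Rabs_pos (layers_gf t c); nra.
  have e : t / rho t * rho t = t by field; lra.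
  by apply/Rabs_le_between; nra.
have := Rabs_triang ((1 + t) * (1 + t) ^ s * rho t ^ r) (t / rho t * layers_gf t c).
rewrite (Rabs_pos_eq _ u0).
have h6 : 1 <= 4 ^ s * 4 ^ r by nra.
have : 4 ^ s * 4 ^ r <= layer_weight c * 4 ^ s * 4 ^ r by nra.
have : layer_weight c <= layer_weight c * 4 ^ s * 4 ^ r by nra.
set w := _ * _ * _ in hw *; nra.
Qed.

Definition partial_sum n st := sum_f_R0 (fun k => INR (tree_count k st) * x ^ k) n.

Lemma partial_sumS n st : partial_sum n.+1 st = 1 + x * rsum (partial_sum n) (kids st).
Proof.
rewrite /partial_sum; elim: n => [|n IH].
  transitivity (1 + x * rsum (fun=> 1) (kids st)); first by rewrite /= INR_sumn /=; ring.
  by congr (_ + _ * _); apply: eq_rsum => a /=; ring.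
rewrite [LHS]tech5 IH [tree_count n.+2 st]/= INR_sumn.
rewrite (@eq_rsum _ (fun st => sum_f_R0 _ n.+1) (fun st' => sum_f_R0 (fun k => INR (tree_count k st') * x ^ k) n - (- x ^ n.+1) * INR (tree_count n.+1 st'))); last first.
  by move=> a; rewrite tech5; ring.
rewrite rsum_sub rsum_scal /=; ring.
Qed.

Lemma partial_sum_error n st :
  Rabs (state_gf t st - partial_sum n st) <= gf_bound * weight st * (32 * Rabs x) ^ n.
Proof.
elim: n st => [|n IH] st.
  by rewrite /partial_sum /= !Rmult_1_r; apply: state_gf_bound.
rewrite partial_sumS state_gf_kids // -x_eq.
rewrite (_ : _ - _ = x * rsum (fun st' => state_gf t st' - partial_sum n st') (kids st)); last first.
  by rewrite rsum_sub; ring.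
rewrite Rabs_mult.
have hx := Rabs_pos x.
have hb : 0 <= gf_bound.
  have := Rabs_pos (mu t); have := Rabs_pos (kappa t); have := Rabs_pos (beta t).
  rewrite /gf_bound; lra.
have hn : 0 <= (32 * Rabs x) ^ n by apply: pow_le; lra.
have h : Rabs (rsum (fun st' => state_gf t st' - partial_sum n st') (kids st))
    <= gf_bound * (32 * Rabs x) ^ n * rsum weight (kids st).
  rewrite -rsum_scal; apply: rsum_abs_le => a.
  by rewrite Rmult_assoc (Rmult_comm _ (weight a)) -Rmult_assoc.
apply: (Rle_trans _ (Rabs x * (gf_bound * (32 * Rabs x) ^ n * (32 * weight st)))); last by right => /=; ring.
apply: Rmult_le_compat_l => //; apply: Rle_trans h _.
by apply: Rmult_le_compat_l; [apply: Rmult_le_pos | apply: kids_weight].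
Qed.

Lemma tree_series st : is_series (fun k => INR (tree_count k st) * x ^ k) (state_gf t st).
Proof.
change (is_lim_seq (sum_n (fun k => INR (tree_count k st) * x ^ k)) (state_gf t st)).
apply: (is_lim_seq_ext (partial_sum^~ st)); first by move=> n; rewrite sum_n_Reals.
have lim0 : is_lim_seq (fun n => gf_bound * weight st * (32 * Rabs x) ^ n) 0.
  have q1 : Rabs (32 * Rabs x) < 1 by have h := Rabs_pos x; rewrite Rabs_pos_eq; lra.
  by have := is_lim_seq_scal_l _ (gf_bound * weight st) _ (is_lim_seq_geom _ q1); rewrite /= Rmult_0_r.
apply: (is_lim_seq_le_le (fun n => state_gf t st - gf_bound * weight st * (32 * Rabs x) ^ n) _
   (fun n => state_gf t st + gf_bound * weight st * (32 * Rabs x) ^ n)).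
- by move=> n; have /Rabs_le_between := partial_sum_error n st; lra.
- by rewrite -[X in is_lim_seq _ (Finite X)]Rminus_0_r; apply: is_lim_seq_minus'; [apply: is_lim_seq_const|].
- by rewrite -[X in is_lim_seq _ (Finite X)]Rplus_0_r; apply: is_lim_seq_plus'; [apply: is_lim_seq_const|].
Qed.

End Convergence.

(** * The generating function of the avoiders *)

(** The radius [/ 100] gives both [Rabs t <= / 10] and [32 * Rabs x < 1]. The exponent is [S n]
    because the root of the tree is the permutation of length 1. *)
Lemma tree_generating_function x : Rabs x < / 100 ->
  is_series (fun n => INR (tree_count n (Open [::] 0)) * x ^ S n)
    ((1 - 8*x + 20*x^2 - 20*x^3 + 10*x^4 - 2*x^5 - (1 - 4*x + 2*x^2) * sqrt (1 - 4*x))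
         / (2 * (1 - 3*x + x^2) * (-1 + 5*x - 4*x^2 + x^3))).
Proof.
move=> hx; have /Rabs_def2 [x1 x2] := hx.
set s := sqrt (1 - 4 * x).
have s0 : 0 <= s by apply: sqrt_pos.
have s2 : s ^ 2 = 1 - 4 * x by rewrite /s pow2_sqrt; lra.
pose t := (1 - s) / (1 + s).
have et : t * (1 + s) = 1 - s by rewrite /t; field; lra.
have t_small : Rabs t <= / 10.
  have s3 : 9 / 10 <= s <= 11 / 10 by nra.
  by apply/Rabs_le_between; nra.
have x_eq : x = xt t.
  have [t1 t2] := t_bounds t_small.
  have es : s = (1 - t) / (1 + t) by apply: (Rmult_eq_reg_r (1 + t)); [rewrite /Rdiv Rmult_assoc Rinv_l; lra | lra].
  by apply: (Rmult_eq_reg_l 4); [transitivity (1 - s ^ 2); [lra | rewrite es /xt; field; lra] | lra].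
rewrite -(state_gf_root t_small s2) //.
have h := @tree_series _ _ t_small x_eq hx (Open [::] 0).
have := is_series_scal x _ _ h.
apply: is_series_ext => n; rewrite /scal /= /mult /=; ring.
Qed.

Theorem theorem5p2 :
  exists r : R, 0 < r /\
    forall x : R, Rabs x < r ->
      is_series (fun n : nat => INR (av_count (S n)) * x ^ (S n))
        ((1 - 8*x + 20*x^2 - 20*x^3 + 10*x^4 - 2*x^5
            - (1 - 4*x + 2*x^2) * sqrt (1 - 4*x))
         / (2 * (1 - 3*x + x^2) * (-1 + 5*x - 4*x^2 + x^3))).
Proof.
exists (/ 100); split; first lra.
move=> x hx; apply: is_series_ext (tree_generating_function hx) => n.
by rewrite av_count_tree.
Qed.
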